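(* Let $n, m \in \mathbb{N}$ and let $T_+$ be an $(n+1)$-periodic and $(2m+1)$-banded Toeplitz operator acting on $\ell^2(\mathbb{N}_0)$. Let $\Phi(\theta)$, $\theta\in[0,2\pi)$, be the symbol of $T_+$. Then \[ \overline{W(T_+)} = \overline{\mathrm{Conv}\left( \bigcup_{\theta \in [0, 2\pi)} W(\Phi(\theta)) \right)}. \]
   Context: $\mathbb{N}$ denotes the positive integers and $\mathbb{N}_0$ the nonnegative integers. For a bounded operator (or matrix) $A$, $W(A)=\{\langle Ax,x\rangle : \|x\|=1\}$ is its numerical range; $\mathrm{Conv}$ denotes the convex hull; the bar denotes closure in $\mathbb{C}$. Periodic banded Toeplitz operators: for each $r=-m,\dots,0,\dots,m$ let $a^{(r)}=(a^{(r)}_j)_{j\in\mathbb{Z}}$ be a complex bi-infinite sequence that is $(n+1)$-periodic, i.e. $a^{(r)}_{j+n+1}=a^{(r)}_j$ for all $j\in\mathbb{Z}$; put $a^{(r)}_j=0$ for all $j$ if $|r|>m$. The $(n+1)$-periodic and $(2m+1)$-banded Toeplitz operator $T$ on $\ell^2(\mathbb{Z})$ defined by these sequences is the bounded operator with matrix entries $\langle T e_k,e_j\rangle=a^{(k-j)}_j$, $j,k\in\mathbb{Z}$ (with $(e_k)$ the canonical basis). The $(n+1)$-periodic and $(2m+1)$-banded Toeplitz operator $T_+$ on $\ell^2(\mathbb{N}_0)$ is the compression of $T$ to $\ell^2(\mathbb{N}_0)$, i.e. $\langle T_+ e_k,e_j\rangle=a^{(k-j)}_j$ for $j,k\in\mathbb{N}_0$.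 Symbol: the symbol of $T$ (also called the symbol of $T_+$) is the function $\Phi:[0,2\pi)\to M_{n+1}(\mathbb{C})$ whose $(j,k)$ entry, $j,k=0,1,\dots,n$, is $\sum_{u\in\mathbb{Z}} e^{iu\theta}\langle T e_{k+u(n+1)},e_j\rangle$ (a finite sum). *)

(* Defs.v *)
From HB Require Import structures.
From mathcomp Require Import all_boot all_order all_algebra.
From mathcomp Require Import complex.
From mathcomp Require Import all_classical all_reals all_analysis.
From mathcomp Require Import ring.
From mathcomp Require summability.

Set Implicit Arguments.
Unset Strict Implicit.
Unset Printing Implicit Defensive.

Import Order.TTheory GRing.Theory Num.Theory.
Import numFieldNormedType.Exports.

Local Open Scope classical_set_scope.
Local Open Scope ring_scope.

Section SquareSummable.
Variables (R : realType) (I : choiceType).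
Local Notation C := R[i].
Local Notation normc := (@ComplexField.Normc.normc R).

Definition square_summable : {pred I -> C} :=
  fun x => `[< (\esum_(i in [set: I]) (normc (x i) ^+ 2)%:E < +oo)%E >].

Lemma normc_sqr (z : C) : normc z ^+ 2 = complex.Re z ^+ 2 + complex.Im z ^+ 2.
Proof. by case: z => a b /=; rewrite sqr_sqrtr// addr_ge0// sqr_ge0. Qed.

Lemma normcD_sqr_le (z w : C) :
  normc (z + w) ^+ 2 <= 2 * normc z ^+ 2 + 2 * normc w ^+ 2.
Proof.
rewrite !normc_sqr; case: z w => [a b] [c d] /=.
rewrite -subr_ge0 (_ : _ - _ = (a - c) ^+ 2 + (b - d) ^+ 2); last by ring.
by rewrite addr_ge0// sqr_ge0.
Qed.

Lemma esum_cst_lt_pinfty (c : R) (f : I -> R) :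
  0 <= c -> (forall i, 0 <= f i) ->
  (\esum_(i in [set: I]) (f i)%:E < +oo)%E ->
  (\esum_(i in [set: I]) (c * f i)%:E < +oo)%E.
Proof.
move=> c0 f0 fy.
apply: (@le_lt_trans _ _ (c%:E * \esum_(i in [set: I]) (f i)%:E)%E); last first.
  by rewrite lte_mul_pinfty// lee_fin.
rewrite ge_ereal_sup//= => _ [X [finX XI]] <-.
rewrite (_ : (\sum_(i \in X) _)%E = (c%:E * \sum_(i \in X) (f i)%:E)%E).
  by rewrite lee_wpmul2l ?lee_fin//; apply: ereal_sup_ubound; exists X.
by rewrite ge0_mule_fsumr// => i; rewrite lee_fin.
Qed.

Lemma square_summable_submod_closed : submod_closed square_summable.
Proof.
split=> [|a x y /asboolP xy /asboolP yy]; apply/asboolP.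
  rewrite esum1// => i _.
  by rewrite ComplexField.Normc.normc0 expr0n.
pose c : R := 2 * normc a ^+ 2.
have c0 : 0 <= c by rewrite mulr_ge0// sqr_ge0.
apply: (@le_lt_trans _ _ (\esum_(i in [set: I])
    ((c * normc (x i) ^+ 2)%:E + (2 * normc (y i) ^+ 2)%:E))%E).
  apply: le_esum => i _; rewrite -EFinD lee_fin.
  apply: le_trans (normcD_sqr_le _ _) _.
  by rewrite lerD2r /c -mulrA -exprMn -ComplexField.Normc.normcM.
rewrite esumD; [|by move=> i _; rewrite lee_fin mulr_ge0// sqr_ge0..].
by rewrite lte_add_pinfty//; apply: esum_cst_lt_pinfty => // i; exact: sqr_ge0.
Qed.

HB.instance Definition _ := GRing.isSubmodClosed.Build _ _ square_summable
  square_summable_submod_closed.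

Record l2 := L2 { l2val :> I -> C; l2valP : l2val \in square_summable }.

HB.instance Definition _ := [isSub for l2val].
HB.instance Definition _ := [Choice of l2 by <:].
HB.instance Definition _ := [SubChoice_isSubLmodule of l2 by <:].

Lemma delta_square_summable (k : I) :
  (fun i : I => (i == k)%:R : C) \in square_summable.
Proof.
apply/asboolP.
rewrite (_ : (\esum_(i in _) _)%E =
  (\esum_(i in [set k]) (normc ((i == k)%:R) ^+ 2)%:E)%E).
  by rewrite esum_set1 ?ltry// lee_fin sqr_ge0.
rewrite [RHS]esum_mkcond; apply: eq_esum => i _.
case: ifPn => // /negP ik; rewrite (_ : i == k = false).
  by rewrite ComplexField.Normc.normc0 expr0n.
by apply/eqP => ik'; apply: ik; rewrite ik' inE.
Qed.

Definition l2delta (k : I) : l2 := L2 (delta_square_summable k).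

(* Unordered sum over [I]: the limit along the finite subsets of [I]; [R[i]^o]
   carries the usual topology of the complex plane. *)
Definition l2dot (x y : l2) : C :=
  summability.sum (fun i => x i * (y i)^* : R[i]^o).

End SquareSummable.

Section Compression.
Variable R : realType.
Local Notation C := R[i].

Lemma extension_square_summable (x : l2 R nat) :
  (fun i : int => if i is Posz k then x k else 0 : C) \in @square_summable R int.
Proof.
have /asboolP xP := l2valP x; apply/asboolP; apply: le_lt_trans xP.
rewrite -(esum_image setT Posz (fun i : int => ((ComplexField.Normc.normc
  (if i is Posz k then x k else 0)) ^+ 2)%:E)); last by move=> ? ? _ _ [].
rewrite [leRHS]esum_mkcond; apply: le_esum => -[k|k] _.
  by rewrite mem_set//; exists k.
by rewrite ComplexField.Normc.normc0 expr0n/=; case: ifP.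
Qed.

Definition l2extend (x : l2 R nat) : l2 R int :=
  L2 (extension_square_summable x).

Lemma restriction_square_summable (x : l2 R int) :
  (fun k : nat => x (Posz k)) \in @square_summable R nat.
Proof.
have /asboolP xP := l2valP x; apply/asboolP; apply: le_lt_trans xP.
rewrite -(esum_image setT Posz (fun i : int => ((ComplexField.Normc.normc
  (x i)) ^+ 2)%:E)); last by move=> ? ? _ _ [].
rewrite esum_mkcond; apply: le_esum => i _.
by case: ifP => // _; rewrite lee_fin sqr_ge0.
Qed.

Definition l2restrict (x : l2 R int) : l2 R nat :=
  L2 (restriction_square_summable x).

Definition compression (T : l2 R int -> l2 R int) (x : l2 R nat) : l2 R nat :=
  l2restrict (T (l2extend x)).

End Compression.

Section NumericalRange.
Variable R : realType.
Local Notation C := R[i].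

Definition cdot (n : nat) (x y : 'cV[C]_n) : C := \sum_(i < n) x i 0 * (y i 0)^*.

Definition dot_norm (V : Type) (dot : V -> V -> C) (x : V) : R :=
  Num.sqrt (complex.Re (dot x x)).

Definition num_range (V : Type) (dot : V -> V -> C) (A : V -> V) : set C^o :=
  [set dot (A x) x | x in [set x | dot_norm dot x = 1]].

(* Convexity in the plane is with respect to real coefficients: [Rcomplex R] is
   [R[i]] seen as a module over [R]. *)
Definition convex_hull (A : set C^o) : set C^o :=
  smallest (@convex_set R (Rcomplex R)) A.

End NumericalRange.

Section Toeplitz.
Variable R : realType.
Local Notation C := R[i].
Local Notation e := (@l2delta R int).

Definition bounded_operator (T : l2 R int -> l2 R int) : Prop :=
  exists M : R, forall x,
    dot_norm (@l2dot R int) (T x) <= M * dot_norm (@l2dot R int) x.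

(* The bands are written [a r j] for the informal a^(r)_j. *)
Definition periodic_banded_toeplitz (n m : nat)
    (T : {linear l2 R int -> l2 R int}) : Prop :=
  bounded_operator T /\
  exists a : int -> int -> C,
    [/\ forall r j, a r (j + n.+1%:Z) = a r j,
        forall r j, (m < `|r|)%N -> a r j = 0 &
        forall j k, l2dot (T (e k)) (e j) = a (k - j) j].

Definition cis (t : R) : C := Complex (cos t) (sin t).

Definition symbol (n : nat) (T : l2 R int -> l2 R int) (t : R) : 'M[C]_n.+1 :=
  \matrix_(j < n.+1, k < n.+1)
    \sum_(u \in [set: int])
      cis (u%:~R * t) *
      l2dot (T (e ((k : nat)%:Z + u * n.+1%:Z))) (e (j : nat)%:Z).

End Toeplitz.

(* Main.v *)
Require Import Defs.
From HB Require Import structures.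
From mathcomp Require Import all_boot all_order all_algebra.
From mathcomp Require Import complex finmap.
From mathcomp Require Import all_classical all_reals all_analysis.
From mathcomp Require Import ring lra zify.
From mathcomp Require summability.
Import Order.TTheory GRing.Theory Num.Theory.
Import numFieldNormedType.Exports.
Local Open Scope classical_set_scope.
Local Open Scope complex_scope.
Local Open Scope ring_scope.

Set Implicit Arguments.
Unset Strict Implicit.
Unset Printing Implicit Defensive.

#[local] Existing Instance summability.totally_filter.

(** Let [F] be the set of values [<T_+ x, x>] at finitely supported unit vectors
    [x], written with blocks of length [n + 1].  Truncating [x] gives
    [W(T_+) <= closure F].  The discrete Fourier transform of the blocks at
    sufficiently many equidistant nodes turns each element of [F] into a finite
    convex combination of elements of the [W(Phi(theta))].  Conversely, truncated
    plane waves approximate each element of [W(Phi(theta))] within [F], and [F] is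
    convex: shifting one of two finitely supported vectors far away by a multiple
    of the period makes the cross terms vanish, by bandedness. *)

(** * Square-summable families *)

Section Plane.
Variable R : realType.
Local Notation C := R[i].

(** Balls of [C^o] have radii in [C]; a positive complex number is real, so real radii suffice. *)
Lemma closureP_norm (A : set C^o) (x : C) :
  closure A x <-> forall e : R, 0 < e -> exists2 a : C, A a & `|x - a| < e%:C.
Proof.
split=> [Ax e e0|Ax B /nbhs_ballP[e /= e0 eB]].
  have /Ax[a [Aa]] : nbhs (x : C^o) (ball (x : C^o) (e%:C)).
    by apply: nbhsx_ballx; rewrite ltcR.
  by rewrite -ball_normE /= => xa; exists a.
have [e' e'E] : exists e', e = e'%:C.
  by exists (complex.Re e); rewrite RRe_real// realE ltW.
subst e; have [] := Ax e'; first by rewrite -ltcR.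
by move=> a Aa xa; exists a; split => //; apply: eB; rewrite -ball_normE.
Qed.

End Plane.

(** With the conjugates as independent variables [c] and [d], polarization is a rational identity;
    it is used with [k] the imaginary unit. *)
Lemma polarization_identity (K : numFieldType) (k a b c d : K) : k ^+ 2 = -1 ->
  a * d = 4^-1 * ((a + b) * (c + d) - (a - b) * (c - d) +
    k * ((a + k * b) * (c + - k * d)) - k * ((a - k * b) * (c - - k * d))).
Proof. by rewrite expr2 => k2; field: k2. Qed.

Section SquareSummableTheory.
Variables (R : realType) (I : choiceType).
Local Notation C := R[i].
Local Notation normc := (@ComplexField.Normc.normc R).
Local Notation dot := (@l2dot R I).
Implicit Types x y z : l2 R I.

Definition l2normsq x : R := fine (\esum_(i in [set: I]) (normc (x i) ^+ 2)%:E).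

Lemma l2normsqE x :
  (\esum_(i in [set: I]) (normc (x i) ^+ 2)%:E)%E = (l2normsq x)%:E.
Proof.
rewrite fineK// ge0_fin_numE; first by have /asboolP := l2valP x.
by apply: esum_ge0 => i _; rewrite lee_fin sqr_ge0.
Qed.

Lemma sum_normsq_le x (A : {fset I}) :
  \sum_(i <- A) normc (x i) ^+ 2 <= l2normsq x.
Proof.
rewrite -lee_fin -l2normsqE -sumEFin; apply: esum_ge.
exists [set` A]; first by split.
by rewrite fsbig_finite// set_fsetK.
Qed.

Lemma sum_normsq_gt x (e : R) : 0 < e ->
  exists A : {fset I}, l2normsq x - e < \sum_(i <- A) normc (x i) ^+ 2.
Proof.
move=> e0; have fx : \esum_(i in [set: I]) (normc (x i) ^+ 2)%:E \is a fin_num.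
  by rewrite l2normsqE.
have [_ [X [finX _] <-]] := ub_ereal_sup_adherent e0 fx.
rewrite -/(esum _ _) l2normsqE fsbig_finite// sumEFin -EFinB lte_fin => h.
by exists (fset_set X).
Qed.

Lemma mulr_conj_normc (z : C) : z * z^* = (normc z ^+ 2)%:C.
Proof. by rewrite -normCK rmorphXn. Qed.

(** The diagonal partial sums are real and grow with the finite set, so they converge to their
    supremum. *)
Lemma l2dotxx_cvg x :
  summability.partial_sum (fun i => x i * (x i)^* : C^o) @ summability.totally
    --> ((l2normsq x)%:C : C^o).
Proof.
have pE (A : {fset I}) :
    summability.partial_sum (fun i => x i * (x i)^* : C^o) A =
    (\sum_(i <- A) normc (x i) ^+ 2)%:C.
  rewrite /summability.partial_sum raddf_sum /= big_seq_fsetE /=.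
  by apply: eq_bigr => i _; rewrite mulr_conj_normc.
apply/cvgrPdist_lt => e e0.
have [e' e'E] : exists e', e = e'%:C.
  by exists (complex.Re e); rewrite RRe_real// realE ltW.
subst e; move: e0; rewrite ltcR => e0.
have [A hA] := sum_normsq_gt x e0.
exists A => // B /= AB; rewrite pE.
rewrite -rmorphB /= ger0_norm; last by rewrite lecR subr_ge0 sum_normsq_le.
rewrite ltcR ltrBlDr -ltrBlDl; apply: lt_le_trans hA _.
have AB' : {subset A <= B} by apply/fsubsetP.
rewrite [leRHS](big_fsetID _ (mem A)) /=.
rewrite (_ : [fset x0 | x0 in B & x0 \in A]%fset = A); last first.
  apply/fsetP => i; rewrite !inE /=.
  by case: (boolP (i \in A)) => [/AB' ->|]; rewrite ?andbF.
by rewrite lerDl; apply: sumr_ge0 => i _; exact: sqr_ge0.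
Qed.

(** The limit defining [l2dot] is meaningful only once it exists; polarization reduces its existence
    to four diagonal sums. *)
Lemma l2dot_cvg x y :
  summability.partial_sum (fun i => x i * (y i)^* : C^o) @ summability.totally
    --> (dot x y : C^o).
Proof.
pose q (z : l2 R I) := fun i => z i * (z i)^* : C^o.
pose f (A : {fset I}) : C^o := 4^-1 * (
  summability.partial_sum (q (x + y)) A
  - summability.partial_sum (q (x - y)) A
  + 'i * summability.partial_sum (q (x + 'i *: y)) A
  - 'i * summability.partial_sum (q (x - 'i *: y)) A).
suff fE : summability.partial_sum (fun i => x i * (y i)^* : C^o) = f.
  rewrite /l2dot /summability.sum fE; apply/cvg_ex.
  eexists; rewrite /f.
  apply: cvgMr; apply: cvgB; [apply: cvgD; [apply: cvgB|]|].
  - exact: l2dotxx_cvg.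
  - exact: l2dotxx_cvg.
  - by apply: cvgMr; exact: l2dotxx_cvg.
  - by apply: cvgMr; exact: l2dotxx_cvg.
apply/funext => A; rewrite /f /summability.partial_sum.
rewrite !mulr_sumr -!sumrN -!big_split /= mulr_sumr; apply: eq_bigr => i _.
move: (val i) => j; rewrite /q /=.
rewrite !(rmorphD, rmorphB, rmorphM, rmorphN) /= conjCi.
exact: (polarization_identity (x j) (y j) (x j)^* (y j)^* (sqrCi _)).
Qed.

Lemma l2dot_unique x y (l : C) :
  summability.partial_sum (fun i => x i * (y i)^* : C^o) @ summability.totally
    --> (l : C^o) -> dot x y = l.
Proof. by move=> h; apply: cvg_unique h => //; exact: l2dot_cvg. Qed.

Lemma l2dotxx x : dot x x = (l2normsq x)%:C.
Proof. exact/l2dot_unique/l2dotxx_cvg. Qed.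

Lemma l2dotP (a : C) x y z : dot (a *: x + y) z = a * dot x z + dot y z.
Proof.
apply: l2dot_unique.
rewrite (_ : summability.partial_sum _ = fun A =>
    a * summability.partial_sum (fun i => x i * (z i)^* : C^o) A +
    summability.partial_sum (fun i => y i * (z i)^* : C^o) A).
  by apply: cvgD; [apply: cvgMr|]; exact: l2dot_cvg.
apply/funext => A; rewrite /summability.partial_sum mulr_sumr -big_split /=.
by apply: eq_bigr => i _; rewrite mulrA -mulrDl.
Qed.

Lemma l2dotC x y : dot y x = (dot x y)^*.
Proof.
apply: l2dot_unique; apply/cvgrPdist_lt => e e0.
have /cvgrPdist_lt/(_ e e0) := @l2dot_cvg x y.
apply: filterS => A; rewrite -norm_conjC rmorphB /=.
congr (`|_ - _| < _); rewrite /summability.partial_sum rmorph_sum.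
by apply: eq_bigr => i _; rewrite rmorphM /= conjCK mulrC.
Qed.

Lemma l2dot_delta x k : dot x (l2delta R k) = x k.
Proof.
apply: l2dot_unique; apply: cvg_near_cst.
exists [fset k]%fset => // A /= kA; rewrite /summability.partial_sum.
rewrite -(big_seq_fsetE _ A xpredT (fun i => x i * ((i == k)%:R)^*)) /=.
have kA' : k \in A by rewrite -fsub1set.
rewrite (big_fsetD1 k)//= eqxx conjC1 mulr1 big_seq_fsetE big1 ?addr0//=.
by move=> i _; have := fsvalP i; rewrite !inE => /andP[/negPf-> _]; rewrite conjC0 mulr0.
Qed.

End SquareSummableTheory.

(** * Hermitian forms and the Cauchy-Schwarz inequality *)

Section SesquilinearForm.
Variables (R : realType) (V : lmodType R[i]).
Local Notation C := R[i].
Variable dot : V -> V -> C.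
Hypothesis dotP : forall (a : C) x y z, dot (a *: x + y) z = a * dot x z + dot y z.
Hypothesis dotC : forall x y, dot y x = (dot x y)^*.
Implicit Types x y z : V.

Lemma hformDl x y z : dot (x + y) z = dot x z + dot y z.
Proof. by have := dotP 1 x y z; rewrite scale1r mul1r. Qed.

Lemma hform0l z : dot 0 z = 0.
Proof. by apply: (addrI (dot 0 z)); rewrite -hformDl !addr0. Qed.

Lemma hformZl a x z : dot (a *: x) z = a * dot x z.
Proof. by have := dotP a x 0 z; rewrite hform0l !addr0. Qed.

Lemma hformBl x y z : dot (x - y) z = dot x z - dot y z.
Proof. by rewrite hformDl -scaleN1r hformZl mulN1r. Qed.

Lemma hform_suml (J : Type) (r : seq J) P (F : J -> V) z :
  dot (\sum_(j <- r | P j) F j) z = \sum_(j <- r | P j) dot (F j) z.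
Proof.
by apply: (big_morph (dot^~ z)); [move=> x y; exact: hformDl|exact: hform0l].
Qed.

Lemma hformDr x y z : dot z (x + y) = dot z x + dot z y.
Proof. by rewrite dotC hformDl rmorphD /= -!dotC. Qed.

Lemma hform0r z : dot z 0 = 0.
Proof. by rewrite dotC hform0l conjC0. Qed.

Lemma hformZr a x z : dot z (a *: x) = a^* * dot z x.
Proof. by rewrite dotC hformZl rmorphM /= -dotC. Qed.

Lemma hformBr x y z : dot z (x - y) = dot z x - dot z y.
Proof. by rewrite dotC hformBl rmorphB /= -!dotC. Qed.

Lemma hform_sumr (J : Type) (r : seq J) P (F : J -> V) z :
  dot z (\sum_(j <- r | P j) F j) = \sum_(j <- r | P j) dot z (F j).
Proof.
by apply: (big_morph (dot z)); [move=> x y; exact: hformDr|exact: hform0r].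
Qed.

Hypothesis dot_ge0 : forall x, 0 <= dot x x.

Lemma dot_norm_ge0 x : 0 <= dot_norm dot x.
Proof. exact: sqrtr_ge0. Qed.

Lemma dot_norm_sqr x : (dot_norm dot x ^+ 2)%:C = dot x x.
Proof.
rewrite /dot_norm sqr_sqrtr ?RRe_real ?ger0_real//.
by rewrite -lecR RRe_real ?ger0_real.
Qed.

Lemma dot_norm_eq1 x : dot_norm dot x = 1 <-> dot x x = 1.
Proof.
split=> h; first by rewrite -dot_norm_sqr h expr1n.
by rewrite /dot_norm h /= sqrtr1.
Qed.

Lemma hform_CauchySchwarz x y : `|dot x y| <= (dot_norm dot x * dot_norm dot y)%:C.
Proof.
suff: `|dot x y| ^+ 2 <= dot x x * dot y y.
  rewrite -!dot_norm_sqr -rmorphM /= -exprMn rmorphXn /=.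
  by rewrite ler_pXn2r// nnegrE lecR mulr_ge0// dot_norm_ge0.
(* This expands [dot z z] for [z = x - (t * dot x y) *: y]. *)
have disc (t : C) : t \is Num.real ->
    0 <= dot x x - 2 * t * `|dot x y| ^+ 2 + t ^+ 2 * `|dot x y| ^+ 2 * dot y y.
  move=> tr; have := dot_ge0 (x - (t * dot x y) *: y).
  rewrite hformBl !hformBr !hformZl !hformZr (dotC x y) rmorphM /= (conj_Creal tr).
  by rewrite normCK; congr (0 <= _); ring.
have [y0|y0] := eqVneq (dot y y) 0.
  rewrite y0 mulr0; have [->//|xy0] := eqVneq (`|dot x y| ^+ 2) 0.
  have rxy : `|dot x y| ^+ 2 \is Num.real by rewrite rpredX ?normr_real.
  have rx : dot x x \is Num.real by rewrite ger0_real.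
  (* As [dot y y = 0], this [t] gives the expansion the value -1. *)
  have := disc ((dot x x + 1) / (2 * `|dot x y| ^+ 2)).
  rewrite y0 mulr0 addr0 => /(_ (rpred_div (rpredD rx (rpred1 _)) _)).
  rewrite (_ : 2 * _ * _ = dot x x + 1); last first.
    by rewrite mulrAC mulrC divfK// mulf_neq0// pnatr_eq0.
  rewrite opprD addrA subrr sub0r oppr_ge0 ler10 => h.
  by suff: false by []; apply: h; rewrite rpredM ?realn.
have yp : 0 < dot y y by rewrite lt_def y0 dot_ge0.
(* The minimising [t]; multiplying by [dot y y] gives the inequality. *)
have := disc (dot y y)^-1; rewrite rpredV ger0_real// => /(_ isT).
rewrite -(pmulr_rge0 _ yp) => h; rewrite -subr_ge0; apply: le_trans h _.
by rewrite le_eqVlt; apply/orP; left; apply/eqP; field.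
Qed.

End SesquilinearForm.

Section ColumnDot.
Variables (R : realType) (p : nat).
Local Notation C := R[i].
Local Notation cdot := (@cdot R p).

Lemma cdotP (a : C) x y z : cdot (a *: x + y) z = a * cdot x z + cdot y z.
Proof.
rewrite /cdot mulr_sumr -big_split; apply: eq_bigr => i _ /=.
by rewrite !mxE mulrDl mulrA.
Qed.

Lemma cdotC x y : cdot y x = (cdot x y)^*.
Proof.
rewrite /cdot rmorph_sum; apply: eq_bigr => i _.
by rewrite rmorphM /= conjCK mulrC.
Qed.

Lemma cdot_ge0 x : 0 <= cdot x x.
Proof. by apply: sumr_ge0 => i _; rewrite -normCK exprn_ge0. Qed.

Lemma cdot_eq0 x : (cdot x x == 0) = (x == 0).
Proof.
apply/idP/eqP => [|->]; last by rewrite (hform0l cdotP).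
rewrite psumr_eq0 => [/allP h|i _]; last by rewrite -normCK exprn_ge0.
apply/colP => i; rewrite mxE; apply/eqP.
by have := h i (mem_index_enum i); rewrite /= -normCK expf_eq0 normr_eq0.
Qed.

End ColumnDot.

(** * Extension, restriction and compression *)

Section SquareSummableNat.
Variable R : realType.
Local Notation C := R[i].

Lemma l2dot_ge0 (I : choiceType) (x : l2 R I) : 0 <= l2dot x x.
Proof.
rewrite l2dotxx lecR /l2normsq fine_ge0//.
by apply: esum_ge0 => i _; rewrite lee_fin sqr_ge0.
Qed.

Lemma dot_norm_l2 (I : choiceType) (x : l2 R I) :
  dot_norm (@l2dot R I) x = Num.sqrt (l2normsq x).
Proof. by rewrite /dot_norm l2dotxx. Qed.

Lemma dot_norm_extend (x : l2 R nat) :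
  dot_norm (@l2dot R int) (l2extend x) <= dot_norm (@l2dot R nat) x.
Proof.
rewrite !dot_norm_l2 ler_wsqrtr// -lee_fin -!l2normsqE.
rewrite -(esum_image setT Posz (fun i : int => ((ComplexField.Normc.normc
  (l2extend x i)) ^+ 2)%:E)); last by move=> ? ? _ _ [].
rewrite [leRHS]esum_mkcond; apply: le_esum => -[k|k] _.
  by rewrite mem_set//; exists k.
by rewrite ComplexField.Normc.normc0 expr0n/=; case: ifP.
Qed.

Lemma dot_norm_restrict (x : l2 R int) :
  dot_norm (@l2dot R nat) (l2restrict x) <= dot_norm (@l2dot R int) x.
Proof.
rewrite !dot_norm_l2 ler_wsqrtr// -lee_fin -!l2normsqE.
rewrite -(esum_image setT Posz (fun i : int => ((ComplexField.Normc.normc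
  (x i)) ^+ 2)%:E)); last by move=> ? ? _ _ [].
rewrite esum_mkcond; apply: le_esum => i _.
by case: ifP => // _; rewrite lee_fin sqr_ge0.
Qed.

Lemma compressionP (T : {linear l2 R int -> l2 R int}) (a : C) (x y : l2 R nat) :
  compression T (a *: x + y) = a *: compression T x + compression T y.
Proof.
rewrite /compression (_ : l2extend (a *: x + y) = a *: l2extend x + l2extend y).
  by rewrite linearP; apply: val_inj; apply/funext.
apply: val_inj; apply/funext => -[//|k].
by change (0 = a * 0 + 0 :> C); rewrite mulr0 addr0.
Qed.

Lemma compression_delta (T : {linear l2 R int -> l2 R int}) (j k : nat) :
  l2dot (compression T (l2delta R k)) (l2delta R j) =
  l2dot (T (l2delta R (Posz k))) (l2delta R (Posz j)).
Proof.
rewrite !l2dot_delta /compression.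
suff -> : l2extend (l2delta R k) = l2delta R (Posz k) by [].
by apply: val_inj; apply/funext => -[i|i].
Qed.

End SquareSummableNat.

(** * Convex sets in the plane and roots of unity *)

Section Convexity.
Variable R : realType.
Local Notation C := R[i].

Lemma convex_setP (A : set C^o) : @convex_set R (Rcomplex R) A <->
  forall (x y : C) (t : R), 0 <= t <= 1 -> A x -> A y ->
    A (t%:C * x + (1 - t)%:C * y).
Proof.
have convE (x y : C) (k : {i01 R}) :
    conv k (x : convex_lmodType (Rcomplex R)) (y : convex_lmodType (Rcomplex R)) =
    (k%:num)%:C * x + (1 - k%:num)%:C * y.
  by case: x y => [a b] [c d]; rewrite /conv /=; simpc.
split=> cA x y t.
  move=> /andP[t0 t1] Ax Ay.
  by have := cA x y (Itv01 t0 t1) (mem_set Ax) (mem_set Ay); rewrite inE convE.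
rewrite !inE convE => Ax Ay; apply: cA => //.
by rewrite ge0 le1.
Qed.

(* A nonnegative combination [v = c w] is either trivial or has [w] in the convex
   set; this property is stable under addition, so no weight is ever divided by
   a possibly vanishing partial sum. *)
Lemma convex_combination (A : set C^o) (J : finType) (c : J -> R) (v : J -> C) :
  @convex_set R (Rcomplex R) A ->
  (forall j, c j = 0 /\ v j = 0 \/ 0 < c j /\ exists2 w, A w & v j = (c j)%:C * w) ->
  \sum_j c j = 1 -> A (\sum_j v j).
Proof.
move=> /convex_setP cA cv.
pose P (d : R) (z : C) := d = 0 /\ z = 0 \/ 0 < d /\ exists2 w, A w & z = d%:C * w.
have PD d1 z1 d2 z2 : P d1 z1 -> P d2 z2 -> P (d1 + d2) (z1 + z2).
  move=> [[-> ->]|[d1p [w1 Aw1 ->]]]; first by rewrite !add0r.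
  move=> [[-> ->]|[d2p [w2 Aw2 ->]]].
    by rewrite !addr0; right; split => //; exists w1.
  have dp : 0 < d1 + d2 by rewrite addr_gt0.
  right; split => //.
  exists ((d1 / (d1 + d2))%:C * w1 + (1 - d1 / (d1 + d2))%:C * w2).
    apply: cA => //; rewrite divr_ge0 ?(ltW d1p) ?(ltW dp)//= ler_pdivrMr// mul1r.
    by rewrite lerDl ltW.
  rewrite mulrDr !mulrA -!rmorphM /=.
  by rewrite mulrBr mulr1 !(mulrC (d1 + d2)) !divfK ?gt_eqF// addrAC subrr add0r.
have : P (\sum_j c j) (\sum_j v j).
  by apply: (big_ind2 P) => [|d1 z1 d2 z2|j _]; [left|exact: PD|exact: cv].
move=> + c1; rewrite c1 => -[[/eqP]|[_ [w Aw ->]]]; first by rewrite oner_eq0.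
by rewrite mul1r.
Qed.

Lemma closure_convex (A : set C^o) :
  @convex_set R (Rcomplex R) A -> @convex_set R (Rcomplex R) (closure A).
Proof.
move=> /convex_setP cA; apply/convex_setP => x y t t01.
move=> /closureP_norm Ax /closureP_norm Ay; apply/closureP_norm => e e0.
have [x' Ax' xx'] := Ax e e0; have [y' Ay' yy'] := Ay e e0.
exists (t%:C * x' + (1 - t)%:C * y'); first exact: cA.
have /andP[t0 t1] := t01.
rewrite (_ : _ - _ = t%:C * (x - x') + (1 - t)%:C * (y - y')); last by ring.
apply: le_lt_trans (ler_normD _ _) _; rewrite !normrM.
rewrite (@ger0_norm _ t%:C) ?lecR// (@ger0_norm _ (1 - t)%:C) ?lecR ?subr_ge0//.
(* The strict bound is taken from the first term, whose weight must then be positive. *)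
have [->|t'] := eqVneq t 0; first by rewrite subr0 rmorph0 rmorph1 mul0r add0r mul1r.
rewrite (_ : e%:C = t%:C * e%:C + (1 - t)%:C * e%:C); last first.
  by rewrite -mulrDl -rmorphD /= addrCA subrr addr0 mul1r.
apply: ltr_leD; first by rewrite ltr_pM2l ?xx'// ltcR lt_def t' t0.
by apply: ler_wpM2l (ltW yy'); rewrite lecR subr_ge0.
Qed.

End Convexity.

Section Cis.
Variable R : realType.
Local Notation C := R[i].
Implicit Types s t : R.

Lemma cisD s t : cis (s + t) = cis s * cis t.
Proof. by rewrite /cis cosD sinD; simpc; congr Complex; rewrite addrC. Qed.

Lemma cis0 : cis (0 : R) = 1.
Proof. by rewrite /cis cos0 sin0. Qed.

Lemma conj_cis t : (cis t)^* = cis (- t).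
Proof. by rewrite /cis cosN sinN. Qed.

Lemma cisMn t k : cis (t *+ k) = cis t ^+ k.
Proof.
elim: k => [|k IH]; first by rewrite mulr0n cis0 expr0.
by rewrite mulrS cisD IH exprS.
Qed.

(** The real part is [1 - 2 * sin (t / 2) ^+ 2], and the sine is positive because [t / 2] lies
    strictly between 0 and [pi]. *)
Lemma cis_neq1 t : 0 < t -> t < 2 * pi -> cis t != 1.
Proof.
move=> t0 t2; apply/negP => /eqP[ct _]; move: ct.
rewrite (splitr t) cosD -!expr2 cos2sin2.
have s0 : 0 < sin (t / 2) by apply: sin_gt0_pi; lra.
move=> h; have /eqP : sin (t / 2) ^+ 2 = 0 by lra.
by rewrite sqrf_eq0 gt_eqF.
Qed.

Lemma cis_2pi_int (z : int) : cis (z%:~R * (2 * pi)) = 1 :> C.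
Proof.
have h : cis (2 * pi) = 1 :> C.
  by rewrite /cis mulr_natl cos2pi sin2pi.
case: z => k; first by rewrite -pmulrn (mulr_natl (2 * pi)) cisMn h expr1n.
rewrite NegzE mulrNz mulNr -conj_cis -pmulrn (mulr_natl (2 * pi)) cisMn h.
by rewrite expr1n conjC1.
Qed.

(** A geometric sum with ratio [w] such that [w ^+ D = 1]; the bound on [z] forces [w != 1] unless
    [z = 0]. *)
Lemma sum_roots_of_unity (D : nat) (z : int) : (`|z| < D)%N ->
  \sum_(l < D) cis (z%:~R * (2 * pi * l%:R / D%:R)) = if z == 0 then D%:R else 0 :> C.
Proof.
move=> zD; have D0 : D%:R != 0 :> R by rewrite pnatr_eq0; case: D zD.
have [->|z0] := eqVneq z 0.
  under eq_bigr do rewrite mul0r cis0.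
  by rewrite sumr_const card_ord.
pose w : C := cis (z%:~R * (2 * pi) / D%:R).
under eq_bigr => l _.
  rewrite (_ : _ * _ = (z%:~R * (2 * pi) / D%:R) *+ l); last first.
    by rewrite -mulr_natr; field.
  rewrite cisMn -/w; over.
have w1 : w != 1.
  have Dp : 0 < D%:R :> R by rewrite lt_def D0 ler0n.
  have key (k : nat) : (0 < k < D)%N -> cis (k%:R * (2 * pi) / D%:R) != 1 :> C.
    move=> /andP[k0 kD]; apply: cis_neq1.
      by rewrite divr_gt0// mulr_gt0 ?ltr0n// mulr_gt0// pi_gt0.
    by rewrite ltr_pdivrMr// [ltRHS]mulrC ltr_pM2r ?ltr_nat// mulr_gt0// pi_gt0.
  rewrite /w; case: z z0 zD {w} => k z0 zD; first by apply: key; lia.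
  (* Negative [z] reduces to the positive case by conjugation. *)
  rewrite NegzE mulrNz -pmulrn !mulNr -conj_cis.
  rewrite -(inj_eq (can_inj (@conjCK _))) conjCK conjC1.
  by apply: key; lia.
apply: (mulfI (_ : w - 1 != 0)); first by rewrite subr_eq0.
rewrite -subrX1 mulr0 -cisMn (_ : _ *+ D = z%:~R * (2 * pi)).
  by rewrite cis_2pi_int subrr.
by rewrite -[LHS]mulr_natr divfK.
Qed.

End Cis.

(** * Quadratic forms of banded block Toeplitz matrices *)

Section BandSum.
Variables (V : zmodType) (m : nat).

(* [Negz i] is [- (i + 1)]: these are the integers [w] with [|w| <= N]. *)
Definition band (N : nat) : seq int :=
  [seq Posz i | i <- iota 0 N.+1] ++ [seq Negz i | i <- iota 0 N].

Lemma mem_band N w : (w \in band N) = (`|w| <= N)%N.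
Proof.
rewrite mem_cat; case: w => k.
  rewrite mem_map ?mem_iota; last by move=> ? ? [].
  rewrite (_ : (Posz k \in _) = false); first by lia.
  by apply/negP => h; have [] := mapP h.
rewrite orbC mem_map ?mem_iota; last by move=> ? ? [].
rewrite (_ : (Negz k \in _) = false); first by lia.
by apply/negP => h; have [] := mapP h.
Qed.

Lemma band_uniq N : uniq (band N).
Proof.
rewrite cat_uniq !map_inj_uniq ?iota_uniq; try by move=> ? ? [].
rewrite andbT; apply/hasPn => w h; have [i _ ->] := mapP h.
by apply/negP => h'; have [] := mapP h'.
Qed.

Lemma sum_band (g : int -> V) N :
  \sum_(w <- band N) g w = \sum_(i < N.+1) g (Posz i) + \sum_(i < N) g (Negz i).
Proof.
rewrite big_cat !big_map -(big_mkord xpredT (fun i => g (Posz i))).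
by rewrite -(big_mkord xpredT (fun i => g (Negz i))) /index_iota !subn0.
Qed.

Lemma fsum_band (g : int -> V) N : (forall w, (m < `|w|)%N -> g w = 0) ->
  (m <= N)%N -> \sum_(w \in [set: int]) g w = \sum_(w <- band N) g w.
Proof.
move=> g0 mN; rewrite (fsbigE (band N)) ?band_uniq//.
  by apply: eq_bigl => w; rewrite in_setT.
by move=> w _; rewrite mem_band -ltnNge => h; apply: g0; exact: leq_ltn_trans h.
Qed.

Lemma sum_band_eq (g : int -> V) w0 : (forall w, (m < `|w|)%N -> g w = 0) ->
  \sum_(w <- band m) (if w == w0 then g w else 0) = g w0.
Proof.
move=> g0; have [w0m|] := boolP (w0 \in band m).
  rewrite (bigD1_seq w0) ?band_uniq//= eqxx big1 ?addr0// => w.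
  by move=> /negPf ->.
rewrite mem_band -ltnNge => w0m; rewrite g0// big1// => w _.
by case: eqP => // ->; exact: g0.
Qed.

(** Enlarging the square by one adds a row, a column and a corner. Their index differences run once
    through an interval containing the whole band, so each enlargement adds the same amount. *)
Lemma sum_toeplitz (g : int -> V) N k : (forall w, (m < `|w|)%N -> g w = 0) ->
  (m <= N)%N ->
  \sum_(u < N + k) \sum_(u' < N + k) g (Posz u' - Posz u) =
  \sum_(u < N) \sum_(u' < N) g (Posz u' - Posz u) + (\sum_(w <- band m) g w) *+ k.
Proof.
move=> g0 mN; elim: k => [|k IH]; first by rewrite addn0 addr0.
rewrite addnS big_ord_recr /= big_ord_recr /= subrr.
under eq_bigr do rewrite big_ord_recr /=.
rewrite big_split /= IH mulrSr -!addrA; congr (_ + _); congr (_ + _).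
rewrite -(@fsum_band g m)// (@fsum_band g (N + k)); [|by []|lia].
rewrite sum_band big_ord_recl addrA [LHS]addrC addrA; congr (_ + _ + _).
  rewrite (reindex_inj rev_ord_inj) /=; apply: eq_bigr => i _; congr g.
  by have := ltn_ord i; rewrite /bump; lia.
rewrite (reindex_inj rev_ord_inj) /=; apply: eq_bigr => i _; congr g.
by have := ltn_ord i; lia.
Qed.

End BandSum.

Section BlockToeplitz.
Variables (R : realType) (n m : nat) (B : int -> 'M[R[i]]_n).
Local Notation C := R[i].
Local Notation cdot := (@cdot R n).
Hypothesis B0 : forall w, (m < `|w|)%N -> B w = 0.
Implicit Types X : nat -> 'cV[C]_n.

Definition toeplitz_form (L : nat) X : C :=
  \sum_(u < L) \sum_(u' < L) cdot (B (Posz u' - Posz u) *m X u') (X u).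

Definition block_norm (L : nat) X : C := \sum_(u < L) cdot (X u) (X u).

Definition block_range : set C^o :=
  [set z | exists L X, block_norm L X = 1 /\ z = toeplitz_form L X].

(** The matrix Laurent polynomial with coefficients [B w], on the unit circle; [symbolE] identifies
    it with [symbol]. *)
Definition trig_symbol (t : R) : 'M[C]_n :=
  \sum_(w <- band m) cis (w%:~R * t) *: B w.

Lemma cdot_mulmx_suml (J : Type) (r : seq J) (F : J -> 'M[C]_n) x y :
  cdot ((\sum_(j <- r) F j) *m x) y = \sum_(j <- r) cdot (F j *m x) y.
Proof. by rewrite mulmx_suml (hform_suml (@cdotP R n)). Qed.

Lemma block_range_convex : @convex_set R (Rcomplex R) block_range.
Proof.
apply/convex_setP => _ _ t /andP[t0 t1] [L1 [X1 [X1n ->]]] [L2 [X2 [X2n ->]]].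
have t1' : 0 <= 1 - t by rewrite subr_ge0.
pose c1 : C := (Num.sqrt t)%:C; pose c2 : C := (Num.sqrt (1 - t))%:C.
have c1E : c1^* * c1 = t%:C.
  by rewrite conj_Creal ?complex_real// -rmorphM -expr2 sqr_sqrtr.
have c2E : c2^* * c2 = (1 - t)%:C.
  by rewrite conj_Creal ?complex_real// -rmorphM -expr2 sqr_sqrtr.
(* The gap of [m] zero blocks decouples the two vectors. *)
pose Z u := if (u < L1)%N then c1 *: X1 u else
  if (L1 + m <= u)%N then c2 *: X2 (u - (L1 + m))%N else 0.
have ZL (u : 'I_L1) : Z u = c1 *: X1 u by rewrite /Z ltn_ord.
have ZM (u : 'I_m) : Z (L1 + u)%N = 0.
  by rewrite /Z; have := ltn_ord u; case: ifP => [|_]; [lia|case: ifP => //; lia].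
have ZR (u : 'I_L2) : Z (L1 + (m + u))%N = c2 *: X2 u.
  rewrite /Z; case: ifP => [|_]; first by lia.
  by case: ifP => [_|]; [congr (_ *: X2 _); lia|lia].
have split3 (f : nat -> C) : \sum_(u < L1 + (m + L2)) f u =
    \sum_(u < L1) f u + (\sum_(u < m) f (L1 + u)%N + \sum_(u < L2) f (L1 + (m + u))%N).
  by rewrite big_split_ord /=; congr (_ + _); rewrite big_split_ord.
have cZ (c : C) (M : 'M[C]_n) (x y : 'cV[C]_n) :
    cdot (M *m (c *: x)) (c *: y) = c^* * c * cdot (M *m x) y.
  by rewrite -scalemxAr (hformZl (@cdotP R n)) (hformZr (@cdotP R n) (@cdotC R n))
    mulrCA mulrA.
have c0 x : cdot x 0 = 0 by rewrite (hform0r (@cdotP R n) (@cdotC R n)).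
have c0' x : cdot 0 x = 0 by rewrite (hform0l (@cdotP R n)).
exists (L1 + (m + L2))%N, Z; split.
  rewrite /block_norm (split3 (fun u => cdot (Z u) (Z u))).
  under eq_bigr do rewrite ZL -[X in cdot X _]mul1mx cZ mul1mx.
  under [X in _ + (X + _)]eq_bigr do rewrite ZM c0.
  under [X in _ + (_ + X)]eq_bigr do rewrite ZR -[X in cdot X _]mul1mx cZ mul1mx.
  rewrite big1_eq add0r -!mulr_sumr.
  rewrite -/(block_norm L1 X1) -/(block_norm L2 X2) X1n X2n !mulr1 c1E c2E.
  by rewrite -rmorphD /= addrC subrK.
rewrite /toeplitz_form.
pose f u := \sum_(u' < L1 + (m + L2)) cdot (B (Posz u' - Posz u) *m Z u') (Z u).
rewrite (split3 f) /f [X in _ + (X + _)]big1 ?add0r; last first.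
  by move=> u _; rewrite big1// => u' _; rewrite ZM c0.
rewrite -c1E -c2E !mulr_sumr; congr (_ + _); apply: eq_bigr => u _.
  rewrite (split3 (fun u' => cdot (B (Posz u' - Posz u) *m Z u') (Z u))).
  rewrite [X in _ + (X + _)]big1 ?add0r => [|u' _]; last by rewrite ZM mulmx0 c0'.
  (* Since [u < L1], these blocks are at distance at least [m + 1]. *)
  rewrite [X in _ + X]big1 ?addr0 => [|u' _]; last first.
    by rewrite B0 ?mul0mx ?c0'//; have := ltn_ord u; lia.
  by rewrite mulr_sumr; apply: eq_bigr => u' _; rewrite !ZL cZ.
rewrite (split3 (fun u' => cdot (B (Posz u' - Posz (L1 + (m + u))%N) *m Z u')
  (Z (L1 + (m + u))%N))).
rewrite [X in _ + (X + _)]big1 ?add0r => [|u' _]; last by rewrite ZM mulmx0 c0'.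
rewrite [X in X + _]big1 ?add0r => [|u' _]; last first.
  by rewrite B0 ?mul0mx ?c0'//; have := ltn_ord u'; lia.
rewrite mulr_sumr; apply: eq_bigr => u' _; rewrite !ZR cZ; congr (_ * cdot (B _ *m _) _).
by lia.
Qed.

Lemma trig_symbol_form t (x y : 'cV[C]_n) : cdot (trig_symbol t *m x) y =
  \sum_(w <- band m) cis (w%:~R * t) * cdot (B w *m x) y.
Proof.
rewrite cdot_mulmx_suml; apply: eq_bigr => w _.
by rewrite -scalemxAl (hformZl (@cdotP R n)).
Qed.

(* The trial vectors are truncated plane waves; their form differs from [N] times
   the value of the symbol by a quantity that does not depend on [N >= m]. *)
Lemma num_range_trig_symbol_closure t :
  num_range cdot (mulmx (trig_symbol t)) `<=` closure block_range.
Proof.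
move=> _ [v /(dot_norm_eq1 (@cdot_ge0 R n)) v1 <-].
apply/closureP_norm => e e0.
pose g (w : int) : C := cis (w%:~R * t) * cdot (B w *m v) v.
have g0 w : (m < `|w|)%N -> g w = 0.
  by move=> /B0 Bw; rewrite /g Bw mul0mx (hform0l (@cdotP R n)) mulr0.
rewrite trig_symbol_form -/(\sum_(w <- band m) g w).
set G := \sum_(w <- _) _.
(* For [N = m + k] the form is [(D0 + G *+ k) / N], which differs from [G] by [(D0 - G *+ m) / N].
   The modulus [r] of that numerator is fixed, and [k] is chosen to make [r / N < e]. *)
pose D0 := \sum_(u < m) \sum_(u' < m) g (Posz u' - Posz u).
pose r : R := complex.Re `|D0 - G *+ m|.
have rE : `|D0 - G *+ m| = r%:C by rewrite /r RRe_real// normr_real.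
have r0 : 0 <= r by rewrite -lecR -rE normr_ge0.
pose k := (Num.bound (r / e)).+1; pose N := (m + k)%N.
have N0 : 0 < N%:R :> R by rewrite ltr0n /N addnS.
have NC0 : N%:R != 0 :> C by rewrite pnatr_eq0 /N addnS.
have rN : r < e * N%:R.
  rewrite mulrC -ltr_pdivrMr//; apply: (@lt_le_trans _ _ (Num.bound (r / e))%:R).
    by apply: archi_boundP; rewrite divr_ge0// ltW.
  by rewrite ler_nat /N /k; lia.
pose c : C := (Num.sqrt N%:R)^-1%:C.
have cE : c * c^* = N%:R^-1.
  rewrite conj_Creal ?complex_real// -rmorphM -invfM -expr2 sqr_sqrtr ?ltW//.
  by rewrite fmorphV rmorph_nat.
pose X u : 'cV[C]_n := (c * cis (u%:R * t)) *: v.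
have XE (M : 'M[C]_n) u u' : cdot (M *m X u') (X u) =
    N%:R^-1 * (cis ((Posz u' - Posz u)%:~R * t) * cdot (M *m v) v).
  rewrite /X -scalemxAr (hformZl (@cdotP R n)) (hformZr (@cdotP R n) (@cdotC R n)).
  rewrite rmorphM /= conj_cis rmorphB /= mulrBl cisD -cE -!pmulrn.
  by ring.
exists (toeplitz_form N X).
  exists N, X; split => //; rewrite /block_norm.
  under eq_bigr => u _.
    rewrite -[X in cdot X _]mul1mx XE mul1mx subrr mul0r cis0 v1 !mulr1; over.
  by rewrite sumr_const card_ord -[LHS]mulr_natr mulVf.
rewrite /toeplitz_form.
under eq_bigr do under eq_bigr do rewrite XE.
under eq_bigr do rewrite -mulr_sumr.
rewrite -mulr_sumr (@sum_toeplitz _ m g m k g0)// -/D0 -/G.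
rewrite (_ : _ - _ = - (N%:R^-1 * (D0 - G *+ m))); last first.
  rewrite -{1}[G](mulKf NC0) -mulrBr -mulrN; congr (_ * _).
  by rewrite mulr_natl /N mulrnDr opprB opprD addrA addrAC -addrA addrC; ring.
rewrite normrN normrM rE normfV normr_nat mulrC -[N%:R](rmorph_nat (real_complex R)).
by rewrite -fmorphV -rmorphM ltcR ltr_pdivrMr.
Qed.

Definition node (D l : nat) : R := 2 * pi * l%:R / D%:R.

(** The transform is not normalised, whence the factors [D%:R] in the identities below. *)
Definition block_dft (D L : nat) X (l : nat) : 'cV[C]_n :=
  \sum_(u < L) cis (- (u%:R * node D l)) *: X u.

(* The frequencies [w - (u' - u)] with [|w| <= m] and [u, u' < L] are smaller than
   [m + L] in absolute value, so [D >= m + L] nodes prevent aliasing. *)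
Lemma block_dft_form D L X : (m + L <= D)%N ->
  \sum_(l < D) cdot (trig_symbol (node D l) *m block_dft D L X l) (block_dft D L X l)
  = D%:R * toeplitz_form L X.
Proof.
move=> mLD.
pose f (u u' : nat) w := cdot (B w *m X u') (X u).
have E l : cdot (trig_symbol (node D l) *m block_dft D L X l) (block_dft D L X l) =
    \sum_(u < L) \sum_(u' < L) \sum_(w <- band m)
      cis ((w - (Posz u' - Posz u))%:~R * node D l) * f u u' w.
  rewrite {2}/block_dft (hform_sumr (@cdotP R n) (@cdotC R n)).
  apply: eq_bigr => u _.
  rewrite /block_dft mulmx_sumr (hform_suml (@cdotP R n)); apply: eq_bigr => u' _.
  rewrite -scalemxAr (hformZl (@cdotP R n)) (hformZr (@cdotP R n) (@cdotC R n)).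
  rewrite trig_symbol_form !mulr_sumr; apply: eq_bigr => w _.
  rewrite conj_cis opprK !rmorphB /= !mulrBl !cisD -!conj_cis -!pmulrn !conj_cis opprB.
  by rewrite /f cisD; ring.
under eq_bigr do rewrite E.
rewrite exchange_big /toeplitz_form mulr_sumr; apply: eq_bigr => u _ /=.
rewrite exchange_big mulr_sumr; apply: eq_bigr => u' _ /=.
(* Summing over the nodes keeps only [w = u' - u]. If this lies outside the band, both sides
   vanish. *)
rewrite exchange_big /= -/(f u u' _) -(@sum_band_eq _ m (f u u')); last first.
  by move=> w /B0 Bw; rewrite /f Bw mul0mx (hform0l (@cdotP R n)).
rewrite mulr_sumr big_seq [RHS]big_seq; apply: eq_bigr => w; rewrite mem_band => wm.
rewrite -mulr_suml sum_roots_of_unity; last first.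
  by have := ltn_ord u; have := ltn_ord u'; lia.
by rewrite subr_eq0; case: ifP => _; rewrite ?mul0r ?mulr0.
Qed.

End BlockToeplitz.

(** * Parseval's identity and the passage to the convex hull *)

Section BlockParseval.
Variables (R : realType) (n m : nat).
Local Notation C := R[i].
Local Notation cdot := (@cdot R n).

Lemma block_dft_norm (D L : nat) (X : nat -> 'cV[C]_n) : (L <= D)%N ->
  \sum_(l < D) cdot (block_dft D L X l) (block_dft D L X l) = D%:R * block_norm L X.
Proof.
move=> LD; pose B (w : int) : 'M[C]_n := if w == 0 then 1%:M else 0.
have B0 w : (0 < `|w|)%N -> B w = 0 by rewrite /B; case: eqP => // ->.
(* Parseval is the special case of the constant symbol [1]. *)
have BE t : trig_symbol 0 B t = 1%:M.
  by rewrite /trig_symbol /band /= big_seq1 mul0r cis0 scale1r.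
have := block_dft_form B0 X (LD : (0 + L <= D)%N).
under eq_bigr do rewrite BE mul1mx.
move=> ->; congr (_ * _); rewrite /toeplitz_form /block_norm.
apply: eq_bigr => u _; rewrite (bigD1 u)//= subrr /B eqxx mul1mx big1 ?addr0//.
move=> u' u'u; rewrite subr_eq0 eqz_nat (_ : (u' == u :> nat) = false); last exact/negbTE.
by rewrite mul0mx (hform0l (@cdotP R n)).
Qed.

(** The squared norms of the transforms divided by [D] are the weights, with sum 1 by Parseval; each
    nonzero transform, once normalised, yields a point of the numerical range at its node. *)
Lemma block_range_sub_hull (B : int -> 'M[C]_n) :
  (forall w, (m < `|w|)%N -> B w = 0) ->
  block_range B `<=` convex_hull
    (\bigcup_(t in `[0, 2 * pi[) num_range cdot (mulmx (trig_symbol m B t))).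
Proof.
move=> B0 _ [L [X [X1 ->]]] K [cK WK].
(* The successor keeps [D] nonzero while [m + L <= D] excludes aliasing. *)
pose D := (m + L).+1; have D0 : D%:R != 0 :> C by rewrite pnatr_eq0.
have D0R : 0 < D%:R :> R by rewrite ltr0n.
pose Y l := block_dft D L X l; pose t l : R := node R D l.
pose c (l : 'I_D) : R := complex.Re (cdot (Y l) (Y l)) / D%:R.
have YE l : cdot (Y l) (Y l) = (complex.Re (cdot (Y l) (Y l)))%:C.
  by rewrite RRe_real// ger0_real// cdot_ge0.
rewrite -(mulKf D0 (toeplitz_form B L X)).
rewrite -(block_dft_form B0 X (leqnSn _ : (m + L <= D)%N)).
rewrite mulr_sumr; apply: (@convex_combination R K _ c) => //; last first.
  rewrite -mulr_suml; apply: (mulIf (lt0r_neq0 D0R)).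
  rewrite divfK ?lt0r_neq0// mul1r; apply: (@complexI R).
  rewrite rmorph_sum /= rmorph_nat.
  under eq_bigr do rewrite -YE.
  by rewrite block_dft_norm ?X1 ?mulr1// /D; lia.
move=> l; rewrite -/(t l) -/(Y l).
have [Y0|Y0] := eqVneq (cdot (Y l) (Y l)) 0.
  (* A vanishing transform cannot be normalised; its weight and its term are both 0. *)
  left; rewrite /c Y0 mul0r; split => //.
  move/eqP: Y0; rewrite cdot_eq0 => /eqP ->.
  by rewrite mulmx0 (hform0l (@cdotP R n)) mulr0.
right; have := YE l; set q := complex.Re _ => qE.
have q0 : 0 < q.
  rewrite lt_def -(inj_eq (@complexI R)) -qE Y0 /=.
  by rewrite -lecR -qE cdot_ge0.
have qC0 : q%:C != 0 :> C by rewrite -qE.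
pose d : C := (Num.sqrt q)^-1%:C.
have dE : d * d^* = (q%:C)^-1.
  rewrite conj_Creal ?complex_real// -rmorphM -invfM -expr2 sqr_sqrtr ?ltW//.
  by rewrite fmorphV.
have dZ M : cdot (M *m (d *: Y l)) (d *: Y l) = (q%:C)^-1 * cdot (M *m Y l) (Y l).
  by rewrite -scalemxAr (hformZl (@cdotP R n)) (hformZr (@cdotP R n) (@cdotC R n))
    mulrA dE.
split; first by rewrite /c divr_gt0.
exists (cdot (trig_symbol m B (t l) *m (d *: Y l)) (d *: Y l)).
  apply: WK; exists (t l).
    rewrite /= in_itv /= /t /node; apply/andP; split.
      by rewrite divr_ge0// mulr_ge0// mulr_ge0// pi_ge0.
    by rewrite ltr_pdivrMr// ltr_pM2l ?ltr_nat// mulr_gt0// pi_gt0.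
  exists (d *: Y l) => //; apply/(dot_norm_eq1 (@cdot_ge0 R n)).
  by rewrite -[X in cdot X _]mul1mx dZ mul1mx qE mulVf.
rewrite dZ mulrA; congr (_ * _).
rewrite /c -/q rmorphM fmorphV rmorph_nat /= mulrAC divff ?mul1r//.
Qed.

End BlockParseval.

(** * Truncation to finitely many blocks *)

Section Assemble.
Variables (R : realType) (n : nat).
Local Notation C := R[i].
Local Notation p := n.+1.
Local Notation dot := (@l2dot R nat).
Local Notation N := (dot_norm dot).
Local Notation e := (@l2delta R nat).
Implicit Types (X : nat -> 'cV[C]_p) (x : l2 R nat).

Let dotP := @l2dotP R nat.
Let dotC := @l2dotC R nat.

Definition assemble (L : nat) X : l2 R nat :=
  \sum_(u < L) \sum_(s < p) X u s 0 *: e (s + u * p)%N.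

Lemma l2dot_assemble x L X :
  dot x (assemble L X) = \sum_(u < L) \sum_(s < p) (X u s 0)^* * x (s + u * p)%N.
Proof.
rewrite (hform_sumr dotP dotC); apply: eq_bigr => u _.
rewrite (hform_sumr dotP dotC); apply: eq_bigr => s _.
by rewrite (hformZr dotP dotC) l2dot_delta.
Qed.

(** Periodicity moves the row index from block [u] to block 0, so an entry depends on the blocks
    only through [u' - u]. An arbitrary [S] allows the use with both the compression and the
    identity. *)
Lemma assemble_form (S : l2 R nat -> l2 R nat) (a : int -> int -> C) L X :
  (forall (c : C) x y, S (c *: x + y) = c *: S x + S y) ->
  (forall r j, a r (j + p%:Z) = a r j) ->
  (forall j k : nat, dot (S (e k)) (e j) = a (Posz k - Posz j) (Posz j)) ->
  dot (S (assemble L X)) (assemble L X) =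
  toeplitz_form (fun w => \matrix_(s < p, s' < p)
    a (Posz s' + w * p%:Z - Posz s) (Posz s)) L X.
Proof.
move=> SP aP Sa.
have aPn r (j u : nat) : a r (Posz (j + u * p)) = a r (Posz j).
  elim: u => [|u IH]; first by rewrite mul0n addn0.
  by rewrite mulSn addnCA addnC PoszD aP IH.
(* The form [dot (S x) y] is linear in [x], which is all that the summation lemmas on the left
   argument require. *)
have bP (c : C) x y z : dot (S (c *: x + y)) z = c * dot (S x) z + dot (S y) z.
  by rewrite SP dotP.
rewrite l2dot_assemble; apply: eq_bigr => u _.
transitivity (\sum_(s < p) \sum_(u' < L) \sum_(s' < p) (X u s 0)^* *
    (X u' s' 0 * a (Posz s' + (Posz u' - Posz u) * p%:Z - Posz s) (Posz s))).
  apply: eq_bigr => s _; rewrite -l2dot_delta.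
  rewrite (hform_suml (dot := fun x y => dot (S x) y) bP) mulr_sumr.
  apply: eq_bigr => u' _.
  rewrite (hform_suml (dot := fun x y => dot (S x) y) bP) mulr_sumr.
  apply: eq_bigr => s' _; congr (_ * _).
  rewrite (hformZl (dot := fun x y => dot (S x) y) bP) Sa aPn; congr (_ * a _ _).
  by rewrite !PoszD !PoszM; ring.
rewrite exchange_big; apply: eq_bigr => u' _ /=; apply: eq_bigr => s _.
rewrite -mulr_sumr mulrC; congr (_ * _).
by rewrite mxE; apply: eq_bigr => s' _; rewrite mxE mulrC.
Qed.

Lemma assemble_norm L X : dot (assemble L X) (assemble L X) = block_norm L X.
Proof.
(* The identity is the Toeplitz operator whose only nonzero band is [r = 0]. *)
have := @assemble_form id (fun r _ => (r == 0)%:R) L X.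
rewrite /= => -> //; last first.
  by move=> j k; rewrite l2dot_delta /= subr_eq0 eqz_nat eq_sym.
apply: eq_bigr => u _; rewrite (bigD1 u)//= [X in _ + X]big1 ?addr0 => [|u' u'u].
  congr cdot; rewrite -[RHS]mul1mx; congr (_ *m _); apply/matrixP => s s'.
  rewrite !mxE subrr mul0r addr0 subr_eq0 eqz_nat eq_sym.
  by congr (_%:R).
rewrite (_ : \matrix_(_, _) _ = 0) ?mul0mx ?(hform0l (@cdotP R p))//.
apply/matrixP => s s'; rewrite !mxE; case: eqP => //.
(* Distinct blocks are shifted by at least [p], more than [s] and [s'] can compensate. *)
have := ltn_ord s; have := ltn_ord s'; have : (u' != u :> nat) by [].
by nia.
Qed.

Lemma sum_blocks (f : nat -> R) L :
  \sum_(u < L) \sum_(s < p) f (s + u * p)%N = \sum_(k < L * p) f k.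
Proof.
elim: L => [|L IH]; first by rewrite mul0n !big_ord0.
rewrite big_ord_recr IH mulSn addnC big_split_ord /=; congr (_ + _).
by apply: eq_bigr => s _; rewrite addnC.
Qed.

Lemma truncation_norm x (d : R) : 0 < d ->
  exists L, (l2normsq x - d)%:C <= block_norm L (fun u => \col_(s < p) x (s + u * p)%N).
Proof.
move=> d0; have [A /ltW hA] := sum_normsq_gt x d0.
(* This number exceeds each index in [A], so the first [L] blocks cover [A]. *)
exists (\sum_(k <- A) k.+1)%N.
set L := (\sum_(k <- A) k.+1)%N.
rewrite (_ : block_norm _ _ =
    (\sum_(k < L * p) ComplexField.Normc.normc (x k) ^+ 2)%:C).
  rewrite lecR; apply: le_trans hA _.
  rewrite -(big_mkord xpredT (fun k => ComplexField.Normc.normc (x k) ^+ 2)).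
  rewrite [leRHS](bigID (mem A)) /= -[X in _ <= X + _]big_filter.
  rewrite [X in _ <= X + _](perm_big A); last first.
    apply: uniq_perm; rewrite ?filter_uniq ?iota_uniq ?fset_uniq// => k.
    rewrite mem_filter mem_index_iota /=.
    case: (boolP (k \in A)) => //= kA.
    have : (k.+1 <= L)%N by rewrite /L (big_fsetD1 k)//= leq_addr.
    by move=> h; apply: leq_trans h _; rewrite leq_pmulr.
  by rewrite lerDl sumr_ge0// => k _; exact: sqr_ge0.
rewrite -(sum_blocks (fun k => ComplexField.Normc.normc (x k) ^+ 2)) rmorph_sum.
apply: eq_bigr => u _; rewrite rmorph_sum; apply: eq_bigr => s _.
by rewrite mxE mulr_conj_normc.
Qed.

(** The quadratic form of a bounded operator is continuous, and a unit vector is a limit of its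
    normalised truncations. *)
Lemma num_range_sub_closure (S : l2 R nat -> l2 R nat) (M : R) (A : set C^o) :
  (forall (c : C) x y, S (c *: x + y) = c *: S x + S y) ->
  (forall x, N (S x) <= M * N x) ->
  (forall L X, block_norm L X = 1 -> A (dot (S (assemble L X)) (assemble L X))) ->
  num_range dot S `<=` closure A.
Proof.
move=> SP SM SA _ [x /= x1 <-]; apply/closureP_norm => eps eps0.
pose K := Num.max M 1.
have K0 : 0 < K by rewrite lt_max ltr01 orbT.
have SK y : N (S y) <= K * N y.
  by apply: le_trans (SM y) _; rewrite ler_wpM2r ?sqrtr_ge0// le_max lexx.
(* The bound 1/2 keeps the truncation nonzero. The other one serves the final estimate:
   [N (x - y) ^+ 2 = 2 - 2 * q <= 2 * d], so [(2 * K * N (x - y)) ^+ 2 <= eps ^+ 2 / 2]. *)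
pose d := Num.min (2^-1) (eps ^+ 2 / (16 * K ^+ 2)).
have d0 : 0 < d.
  by rewrite lt_min invr_gt0 ltr0n /= divr_gt0// ?mulr_gt0// exprn_gt0.
have d2 : d <= 2^-1 by rewrite ge_min lexx.
have dK : d * (16 * K ^+ 2) <= eps ^+ 2.
  rewrite -ler_pdivlMr ?mulr_gt0// ?exprn_gt0//.
  by rewrite ge_min lexx orbT.
have [L hL] := truncation_norm x d0.
set X := (fun u => _) in hL.
have xx : dot x x = 1 by apply/(dot_norm_eq1 (@l2dot_ge0 R nat)).
have nx : l2normsq x = 1 by apply: (@complexI R); rewrite -l2dotxx xx.
pose xL := assemble L X.
(* As [xL] truncates [x], its product with [x] is its own squared norm. *)
have xxL : dot x xL = block_norm L X.
  rewrite l2dot_assemble; apply: eq_bigr => u _; apply: eq_bigr => s _.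
  by rewrite mxE mulrC.
pose c : R := complex.Re (block_norm L X).
have cE : block_norm L X = c%:C.
  rewrite /c RRe_real// ger0_real// -assemble_norm; exact: l2dot_ge0.
move: hL; rewrite nx cE lecR => hc.
have c0 : 0 < c by lra.
pose q := Num.sqrt c; have q0 : 0 < q by rewrite sqrtr_gt0.
have qq : q ^+ 2 = c by rewrite sqr_sqrtr// ltW.
pose Y u := (q^-1)%:C *: X u; pose y := assemble L Y.
have yE : y = (q^-1)%:C *: xL.
  rewrite /y /xL /assemble scaler_sumr; apply: eq_bigr => u _.
  by rewrite scaler_sumr; apply: eq_bigr => s _; rewrite mxE scalerA.
have yy : dot y y = 1.
  rewrite yE (hformZl dotP) (hformZr dotP dotC) assemble_norm cE -qq.
  rewrite conj_Creal ?complex_real// -!rmorphM /= -[RHS]/(1%:C); congr (_%:C).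
  by field; rewrite gt_eqF.
have xy : dot x y = q%:C.
  rewrite yE (hformZr dotP dotC) xxL cE -qq conj_Creal ?complex_real// -rmorphM.
  by congr (_%:C); field; rewrite gt_eqF.
have Ny : N y = 1 by apply/(dot_norm_eq1 (@l2dot_ge0 R nat)).
exists (dot (S y) y); first by apply: SA; rewrite -assemble_norm.
have Nxy : N (x - y) ^+ 2 = 2 - 2 * q.
  apply: (@complexI R); rewrite (dot_norm_sqr (@l2dot_ge0 R nat)).
  rewrite (hformBl dotP) !(hformBr dotP dotC) xx yy xy (dotC x y) xy.
  rewrite conj_Creal ?complex_real//.
  by rewrite rmorphB rmorphM /= !rmorph_nat; ring.
have c1 : c <= 1.
  have : 0 <= N (x - y) ^+ 2 by exact: sqr_ge0.
  by rewrite Nxy -qq => h; nra.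
have Nxy' : 2 * K * N (x - y) < eps.
  rewrite -(@ltr_pXn2r _ 2)// ?nnegrE ?mulr_ge0 ?sqrtr_ge0 ?ltW//.
  by rewrite exprMn Nxy; nra.
have SB : S (x - y) = S x - S y.
  by have := SP (-1) y x; rewrite !scaleN1r addrC => ->; rewrite addrC.
rewrite (_ : _ - _ = dot (S (x - y)) x + dot (S y) (x - y)); last first.
  by rewrite SB (hformBl dotP) (hformBr dotP dotC); ring.
have CS := hform_CauchySchwarz dotP dotC (@l2dot_ge0 R nat).
apply: le_lt_trans (ler_normD _ _) _.
apply: le_lt_trans (lerD (CS _ _) (CS _ _)) _.
rewrite -rmorphD ltcR /=; apply: le_lt_trans Nxy'.
rewrite x1 mulr1.
have := SK (x - y); have := SK y; rewrite Ny mulr1.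
have := sqrtr_ge0 (complex.Re (dot (x - y) (x - y))); rewrite -/(dot_norm dot (x - y)).
by move=> h1 h2 h3; nra.
Qed.

End Assemble.

(** * Identification of the symbol and the two inclusions *)

Lemma symbolE (R : realType) (n m : nat) (T : l2 R int -> l2 R int)
    (a : int -> int -> R[i]) (t : R) :
  (forall r j, (m < `|r|)%N -> a r j = 0) ->
  (forall j k, l2dot (T (l2delta R k)) (l2delta R j) = a (k - j) j) ->
  symbol n T t = trig_symbol m (fun w => \matrix_(s < n.+1, s' < n.+1)
    a (Posz s' + w * n.+1%:Z - Posz s) (Posz s)) t.
Proof.
move=> a0 Ta; apply/matrixP => s s'; rewrite mxE.
under eq_fsbigr do rewrite Ta.
rewrite (@fsum_band _ m _ m)//.
  rewrite /trig_symbol summxE; apply: eq_bigr => w _; rewrite !mxE; congr (_ * a _ _).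
(* For [m < |w|] the offset [s' + w * (n + 1) - s] also exceeds [m] in absolute value, because
   [|s' - s| <= n]. *)
move=> w wm; rewrite a0 ?mulr0//.
by have := ltn_ord s; have := ltn_ord s'; nia.
Qed.

Theorem theorem2p7 (R : realType) (n m : nat) (hn : (0 < n)%N) (hm : (0 < m)%N)
    (T : {linear l2 R int -> l2 R int})
    (hT : periodic_banded_toeplitz n m T) :
  closure (num_range (@l2dot R nat) (compression T)) =
  closure (convex_hull
    (\bigcup_(t in `[0, 2 * pi[)
       num_range (@cdot R n.+1) (mulmx (symbol n T t)))).
Proof.
have [[M TM] [a [aP a0 Ta]]] := hT.
pose B (w : int) : 'M[R[i]]_n.+1 := \matrix_(s, s')
  a (Posz s' + w * n.+1%:Z - Posz s) (Posz s).
have B0 w : (m < `|w|)%N -> B w = 0.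
  move=> wm; apply/matrixP => s s'; rewrite !mxE a0//.
  by have := ltn_ord s; have := ltn_ord s'; nia.
have symE t : symbol n T t = trig_symbol m B t by exact: symbolE.
have Sa (j k : nat) : l2dot (compression T (l2delta R k)) (l2delta R j) =
    a (Posz k - Posz j) (Posz j) by rewrite compression_delta Ta.
have SF L X : l2dot (compression T (assemble L X)) (assemble L X) =
    toeplitz_form B L X.
  by rewrite (assemble_form L X (compressionP T) aP Sa).
(* The maximum guards against a negative [M], since the norm of the extension is bounded under this
   factor. *)
have SM x : dot_norm (@l2dot R nat) (compression T x) <=
    Num.max M 0 * dot_norm (@l2dot R nat) x.
  apply: le_trans (dot_norm_restrict _) _; apply: le_trans (TM _) _.
  apply: (@le_trans _ _ (Num.max M 0 * dot_norm (@l2dot R int) (l2extend x))).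
    by rewrite ler_wpM2r ?sqrtr_ge0// le_max lexx.
  by rewrite ler_wpM2l ?dot_norm_extend// le_max lexx orbT.
have WE : (\bigcup_(t in `[0, 2 * pi[) num_range (@cdot R n.+1) (mulmx (symbol n T t)))
    = \bigcup_(t in `[0, 2 * pi[) num_range (@cdot R n.+1) (mulmx (trig_symbol m B t)).
  by apply: eq_bigcupr => t _; rewrite symE.
rewrite WE; apply/seteqP; split.
  rewrite closureE; apply: smallest_sub; first exact: closed_closure.
  apply: (num_range_sub_closure (compressionP T) SM) => L X X1.
  by apply: (block_range_sub_hull B0); exists L, X; rewrite SF.
rewrite closureE; apply: smallest_sub; first exact: closed_closure.
(* The closure of [block_range B] is convex, so it contains the hull as soon as it contains each
   numerical range. *)
apply: (@subset_trans _ (closure (block_range B))).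
  apply: smallest_sub; first exact: closure_convex (block_range_convex B0).
  by move=> z [t _]; exact: num_range_trig_symbol_closure.
apply: closureS => _ [L [X [X1 ->]]]; exists (assemble L X); last exact: SF.
by apply/(dot_norm_eq1 (@l2dot_ge0 R nat)); rewrite assemble_norm.
Qed.
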